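(* Let $\mathcal M$ and $D$ be two finite MDPs with the same state space $\mathcal S$, action space $\mathcal A$ and discount factor $\gamma\in[0,1)$ ($\mathcal M$ the true environment, $D$ the MDP estimated from a dataset), and let $\Pi$ be the set of all policies. For every state $s\in\mathcal S$, $$\mathbf q^*(s,a^* )-(\mathbf q^{\pi_D^*})^*(s,a^{\pi_D^*})\le\inf_{\pi\in\Pi}\Big(\big[\mathbf q^*(s,a^{\pi^*})-\hat{\mathbf q}_D^*(s,a^{\pi^*})\big]+\big[\hat{\mathbf q}_D^*(s,a^{\pi^*})-(\hat{\mathbf q}_D^{\pi})^*(s,a^{\pi})\big]\Big)+\sup_{\pi\in\Pi}\Big((\hat{\mathbf q}_D^{\pi})^*(s,a^{\pi})-(\mathbf q^{\pi})^*(s,a^{\pi})\Big).$$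
   Context: $\mathcal S,\mathcal A$ are finite and nonempty. A policy is a map $\pi:\mathcal S\to\Delta(\mathcal A)$. $\mathcal M$ has expected rewards $\mathbf r_{\mathcal M}$ and transitions $P_{\mathcal M}$; $D$ has bounded (empirical) rewards $\mathbf r_D$ and stochastic (empirical) transitions $P_D$. For an MDP $\xi\in\{\mathcal M,D\}$ and a policy $\pi$, the policy's Q-function $(\mathbf q_\xi^\pi)^*\in\mathbb R^{|\mathcal S\times\mathcal A|}$ is the unique solution of $$\mathbf q(s,a)=\mathbf r_\xi(s,a)+\gamma\sum_{s'}P_\xi(s'\mid s,a)\sum_{a'}\pi(a'\mid s')\mathbf q(s',a'),$$ and $\mathbf q_\xi^*=(\mathbf q_\xi^{\pi_\xi^*})^*$ is the Q-function of an optimal policy $\pi_\xi^*$. When the subscript is omitted, $\xi=\mathcal M$: $(\mathbf q^\pi)^*=(\mathbf q_{\mathcal M}^\pi)^*$, $\mathbf q^*=\mathbf q_{\mathcal M}^*$, $\pi^*=\pi^*_{\mathcal M}$. A hat denotes the Q-function learned on $D$ with heuristic guidance, whose converged (fixed-point) values on $D$ are those of the unguided Q-function: $(\hat{\mathbf q}_D^\pi)^*=(\mathbf q_D^\pi)^*$ and $\hat{\mathbf q}_D^*=\mathbf q_D^*$. For the state $s$: $a^*=a^{\pi^*}\in\arg\max_a\mathbf q^*(s,a)$; $a^{\pi_D^*}\in\arg\max_a\mathbf q_D^*(s,a)$; and for any policy $\pi$, $a^\pi\in\arg\max_a\pi(a\mid s)$ (ties broken by a fixed rule). $\pi_D^*$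 is the deterministic greedy policy for $\mathbf q_D^*$, which picks the action $a^{\pi_D^*}$ at $s$. *)

(* Defs.v *)
From HB Require Import structures.
From mathcomp Require Import all_boot all_order all_algebra.
From mathcomp Require Import boolp classical_sets reals.

Set Implicit Arguments.
Unset Strict Implicit.
Unset Printing Implicit Defensive.

Import Order.TTheory GRing.Theory Num.Theory.
Local Open Scope ring_scope.
Local Open Scope classical_set_scope.

Record fdist (R : realType) (T : finType) := FDist {
  pmf :> T -> R;
  pmf_ge0 : forall x, 0 <= pmf x;
  pmf_sum1 : \sum_x pmf x = 1 }.

Lemma dirac_ge0 (R : realType) (T : finType) (a x : T) :
  0 <= (x == a)%:R :> R.
Proof. exact: ler0n. Qed.

Lemma dirac_sum1 (R : realType) (T : finType) (a : T) :
  \sum_x (x == a)%:R = 1 :> R.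
Proof.
rewrite (bigD1 a) //= eqxx big1 ?addr0 // => x /negbTE ->.
by [].
Qed.

Definition fdist_dirac (R : realType) (T : finType) (a : T) : fdist R T :=
  FDist (@dirac_ge0 R T a) (@dirac_sum1 R T a).

Record mdp (R : realType) (S A : finType) := MDP {
  reward : S -> A -> R;
  trans : S -> A -> fdist R S }.

Definition policy (R : realType) (S A : finType) := S -> fdist R A.

Definition det_policy (R : realType) (S A : finType) (g : S -> A) :
    policy R S A :=
  fun s => fdist_dirac R (g s).

Definition bellman (R : realType) (S A : finType) (gamma : R) (xi : mdp R S A)
    (pi : policy R S A) (q : S -> A -> R) : Prop :=
  forall s a, q s a = reward xi s a +
    gamma * \sum_s' trans xi s a s' * \sum_a' pi s' a' * q s' a'.

(* The default 0 is never reached when 0 <= gamma < 1: see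
   [bellman_unique_solution]. *)
Definition qfun (R : realType) (S A : finType) (gamma : R) (xi : mdp R S A)
    (pi : policy R S A) : S -> A -> R :=
  xget (fun _ _ => 0) [set q | bellman gamma xi pi q].

Definition vfun (R : realType) (S A : finType) (gamma : R) (xi : mdp R S A)
    (pi : policy R S A) (s : S) : R :=
  \sum_a pi s a * qfun gamma xi pi s a.

(* Comparing values at every state is in general more demanding than comparing
   Q-functions, but all optimal policies share the same Q-function. *)
Definition optimal_policy (R : realType) (S A : finType) (gamma : R)
    (xi : mdp R S A) (pi : policy R S A) : Prop :=
  forall (pi' : policy R S A) (s : S),
    vfun gamma xi pi' s <= vfun gamma xi pi s.

Definition optimal_qfun (R : realType) (S A : finType) (gamma : R)
    (xi : mdp R S A) (q : S -> A -> R) : Prop :=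
  exists2 pi : policy R S A, optimal_policy gamma xi pi & q = qfun gamma xi pi.

Definition argmax (R : realType) (A : finType) (f : A -> R) : {set A} :=
  [set a | [forall b, f b <= f a]]%SET.

Lemma fdist_avg_le (R : realType) (T : finType) (p : fdist R T) (f : T -> R)
    (c : R) : (forall x, `|f x| <= c) -> `|\sum_x p x * f x| <= c.
Proof.
move=> fc; apply: le_trans (ler_norm_sum _ _ _) _.
rewrite -[leRHS]mul1r -(pmf_sum1 p) mulr_suml; apply: ler_sum => x _.
by rewrite normrM (ger0_norm (pmf_ge0 p x)) ler_wpM2l // pmf_ge0.
Qed.

Lemma bellman_unique_solution (R : realType) (S A : finType) (gamma : R)
    (xi : mdp R S A) (pi : policy R S A) :
  0 <= gamma < 1 -> exists! q : S -> A -> R, bellman gamma xi pi q.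
Proof.
case/andP=> g0 g1.
pose T (q : S -> A -> R) s a :=
  gamma * \sum_s' trans xi s a s' * \sum_a' pi s' a' * q s' a'.
have T0 q : (forall s a, q s a = T q s a) -> forall s a, q s a = 0.
  move=> qT s a; pose c := \big[Num.max/0]_(x : S * A) `|q x.1 x.2|.
  have qc t b : `|q t b| <= c.
    by rewrite /c (bigD1 (t, b)) //= le_max lexx.
  have qgc t b : `|q t b| <= gamma * c.
    rewrite qT normrM (ger0_norm g0) ler_wpM2l //.
    by apply: fdist_avg_le => u; apply: fdist_avg_le.
  have c0 : 0 <= c by apply: le_trans (qc s a).
  have cg : c <= gamma * c.
    apply/bigmax_leP; split=> [|x _]; [exact: mulr_ge0 | exact: qgc].
  have c_le0 : c <= 0.
    have : (1 - gamma) * c <= 0 by rewrite mulrBl mul1r subr_le0.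
    by rewrite pmulr_rle0 // subr_gt0.
  by apply/eqP; rewrite -normr_le0; apply: le_trans (qc s a) _.
have TL k q1 q2 s a :
    T (fun t b => k * q1 t b + q2 t b) s a = k * T q1 s a + T q2 s a.
  rewrite /T mulrCA -mulrDr; congr (_ * _).
  rewrite mulr_sumr -big_split; apply: eq_bigr => t _ /=.
  rewrite mulrCA -mulrDr; congr (_ * _).
  rewrite mulr_sumr -big_split; apply: eq_bigr => b _ /=.
  by rewrite mulrCA -mulrDr.
pose L (f : {ffun S * A -> R^o}) : {ffun S * A -> R^o} :=
  [ffun x => f x - T (fun s a => f (s, a)) x.1 x.2].
have Llin : linear L.
  move=> k f h; apply/ffunP=> -[s a]; rewrite !ffunE /=.
  have -> : T (fun s a => (k *: f + h) (s, a)) s a =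
    k * T (fun s a => f (s, a)) s a + T (fun s a => h (s, a)) s a.
    rewrite -TL; congr (T _ s a); apply/funext=> t; apply/funext=> b.
    by rewrite !ffunE.
  by rewrite /GRing.scale /= mulrBr opprD addrACA.
pose LL := GRing.isLinear.Build R _ _ _ L Llin.
pose Lf : {linear {ffun S * A -> R^o} -> {ffun S * A -> R^o}} :=
  HB.pack L LL.
have kL : lker (linfun Lf) == 0%VS.
  apply/lker0P => f h; rewrite !(lfunE Lf) => LfLh.
  have fh : L (f - h) = 0 by have LB : Lf (f - h) = Lf f - Lf h := raddfB Lf f h; rewrite [LHS]LB LfLh subrr.
  apply/eqP; rewrite -subr_eq0; apply/eqP/ffunP=> -[s a]; rewrite [RHS]ffunE.
  apply: (T0 (fun s a => (f - h) (s, a))) => t b.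
  by apply/eqP; rewrite -subr_eq0; move/ffunP/(_ (t, b)): fh; rewrite !ffunE /= => ->.
pose f := ((linfun Lf)^-1)%VF [ffun x => reward xi x.1 x.2].
have fE : L f = [ffun x => reward xi x.1 x.2].
  by rewrite -[L f](lfunE Lf f); exact: (lker0_lfunVK kL).
exists (fun s a => f (s, a)); split=> [s a|q qB].
  move/ffunP/(_ (s, a)): fE; rewrite !ffunE /= => <-.
  by rewrite -/(T (fun s a => f (s, a)) s a) subrK.
apply/funext=> s; apply/funext=> a; apply/eqP; rewrite -subr_eq0; apply/eqP.
apply: (T0 (fun s a => f (s, a) - q s a)) => t b.
have -> : (fun s a => f (s, a) - q s a) =
    (fun s a => (-1) * q s a + f (s, a)).
  by apply/funext=> u; apply/funext=> c; rewrite mulN1r addrC.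
rewrite TL mulN1r qB -/(T q t b).
move/ffunP/(_ (t, b)): fE; rewrite !ffunE /= => <-.
by rewrite opprD opprB addrA [X in X - _]addrC subrK addrC.
Qed.

(* Main.v *)
Require Import Defs.
From mathcomp Require Import all_boot all_order all_algebra.
From mathcomp Require Import boolp classical_sets reals.

Import Order.TTheory GRing.Theory Num.Theory.
Local Open Scope ring_scope.
Local Open Scope classical_set_scope.

Set Implicit Arguments.
Unset Strict Implicit.

(** Write [f pi] and [g pi] for the Q-values of [pi] in [D] and [M] at [s] and at
    the action of [pi].  The greedy policy [piD] maximizes [f]: the Q-function of
    every policy on [D] lies below [qD], and [qD] is a subsolution of the Bellman
    equation of [piD], hence lies below its Q-function.  So the infimum is
    attained at [piD], and the right-hand side is at least
    [(q - f piD) + (f piD - g piD)], where [q] is the left term [qM s astar]. *)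

Lemma fdist_avg_mono (R : realType) (T : finType) (p : fdist R T)
    (f g : T -> R) :
  (forall x, f x <= g x) -> \sum_x p x * f x <= \sum_x p x * g x.
Proof. by move=> fg; apply: ler_sum => x _; rewrite ler_wpM2l ?pmf_ge0. Qed.

Lemma fdist_avg_cst (R : realType) (T : finType) (p : fdist R T) (c : R) :
  \sum_x p x * c = c.
Proof. by rewrite -mulr_suml pmf_sum1 mul1r. Qed.

Lemma fdist_avg_sub (R : realType) (T : finType) (p : fdist R T)
    (f g : T -> R) :
  \sum_x p x * f x - \sum_x p x * g x = \sum_x p x * (f x - g x).
Proof. by rewrite -sumrB; apply: eq_bigr => x _; rewrite mulrBr. Qed.

Lemma fdist_dirac_avg (R : realType) (T : finType) (a : T) (f : T -> R) :
  \sum_x fdist_dirac R a x * f x = f a.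
Proof.
rewrite (bigD1 a) //= eqxx mul1r big1 ?addr0 // => x /negbTE ->.
by rewrite mul0r.
Qed.

(** Forces any tie-breaking rule to select, for a deterministic policy, the action which that policy
    takes. *)
Lemma argmax_dirac (R : realType) (T : finType) (a b : T) :
  b \in argmax (fdist_dirac R a) -> b = a.
Proof.
rewrite inE => /forallP/(_ a) /=; rewrite eqxx.
by case: eqP => // _; rewrite ler10.
Qed.

Section QFunctions.
Context (R : realType) (S A : finType) (gamma : R).
Hypothesis hgamma : 0 <= gamma < 1.
Implicit Types (xi : mdp R S A) (pi : policy R S A) (q : S -> A -> R).

Lemma qfun_bellman xi pi : bellman gamma xi pi (qfun gamma xi pi).
Proof.
have [q [qB _]] := bellman_unique_solution xi pi hgamma.
exact: (xgetPex (fun _ _ => 0) (ex_intro _ q qB)).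
Qed.

(** The excess of [q] over the Q-function is at most [gamma] times an average of excesses, so its
    maximum cannot be positive, as [gamma < 1]. *)
Lemma bellman_subsolution_le_qfun xi pi q :
  (forall s a, q s a <= reward xi s a +
    gamma * \sum_s' trans xi s a s' * \sum_a' pi s' a' * q s' a') ->
  forall s a, q s a <= qfun gamma xi pi s a.
Proof.
case/andP: hgamma => g0 g1 q_sub s a.
pose d t b := q t b - qfun gamma xi pi t b.
(* Starting the maximum at 0 ensures [0 <= gamma * c], the base case of [cg]. *)
pose c := \big[Num.max/0]_(x : S * A) d x.1 x.2.
have dc t b : d t b <= c by rewrite /c (bigD1 (t, b)) //= le_max lexx.
have c0 : 0 <= c by rewrite /c; apply: bigmax_ge_id.
have dgc t b : d t b <= gamma * c.
  apply: (@le_trans _ _ (gamma *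
      \sum_s' trans xi t b s' * \sum_a' pi s' a' * d s' a')).
    rewrite /d [X in _ - X <= _]qfun_bellman.
    under [X in _ <= gamma * X]eq_bigr => u _ do rewrite -fdist_avg_sub.
    rewrite -fdist_avg_sub mulrBr lerBlDr.
    apply: le_trans (q_sub t b) _.
    by rewrite addrCA subrK.
  rewrite ler_wpM2l // -[leRHS](fdist_avg_cst (trans xi t b)).
  apply: fdist_avg_mono => u.
  by rewrite -[leRHS](fdist_avg_cst (pi u)); apply: fdist_avg_mono.
have cg : c <= gamma * c.
  by apply/bigmax_leP; split=> [|x _]; [exact: mulr_ge0 | exact: dgc].
have c_le0 : c <= 0.
  have : (1 - gamma) * c <= 0 by rewrite mulrBl mul1r subr_le0.
  by rewrite pmulr_rle0 // subr_gt0.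
by rewrite -subr_le0; apply: le_trans (dc s a) c_le0.
Qed.

(** The bound is uniform in the policy: it serves to show that the set under [sup] in the theorem is
    bounded above. *)
Lemma qfun_lower_bound xi :
  exists c, forall pi s a, c <= qfun gamma xi pi s a.
Proof.
case/andP: hgamma => g0 g1.
pose m := \big[Num.max/0]_(x : S * A) `|reward xi x.1 x.2|.
exists (- (m / (1 - gamma))) => pi s a.
(* The constant [- m / (1 - gamma)] solves [x = - m + gamma * x]. *)
apply: (bellman_subsolution_le_qfun (q := fun _ _ => - (m / (1 - gamma)))).
move=> t b.
under eq_bigr => u _ do rewrite fdist_avg_cst.
rewrite fdist_avg_cst mulrN -lerBlDr opprK.
have -> : - (m / (1 - gamma)) + gamma * (m / (1 - gamma)) = - m.
  rewrite -[X in - X + _]mul1r -mulNr -mulrDl addrC -opprB mulNr mulrC divfK //.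
  by rewrite gt_eqF // subr_gt0.
have : `|reward xi t b| <= m by rewrite /m (bigD1 (t, b)) //= le_max lexx.
by rewrite ler_norml => /andP[].
Qed.

(** Optimality compares state values only; one Bellman step carries it over to every action. *)
Lemma qfun_le_optimal xi q pi s a :
  optimal_qfun gamma xi q -> qfun gamma xi pi s a <= q s a.
Proof.
case=> pio opt ->; rewrite qfun_bellman [leRHS]qfun_bellman.
case/andP: hgamma => g0 _; rewrite lerD2l ler_wpM2l //.
by apply: fdist_avg_mono => t; exact: opt.
Qed.

(** Unfold [q] by the Bellman equation of an optimal policy [pio]: an average of [q u] over [pio u]
    is at most its value at the greedy action. *)
Lemma optimal_le_qfun_greedy xi q (g : S -> A) s a :
  optimal_qfun gamma xi q -> (forall t, g t \in argmax (q t)) ->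
  q s a <= qfun gamma xi (det_policy R g) s a.
Proof.
case=> pio _ qE gP; apply: bellman_subsolution_le_qfun => t b.
rewrite {1}qE qfun_bellman -qE.
case/andP: hgamma => g0 _; rewrite lerD2l ler_wpM2l //.
apply: fdist_avg_mono => u; rewrite fdist_dirac_avg.
rewrite -[leRHS](fdist_avg_cst (pio u)); apply: fdist_avg_mono => c.
by have := gP u; rewrite inE => /forallP.
Qed.

End QFunctions.

Theorem mainTheorem2 (R : realType) (S A : finType)
  (hS : (0 < #|S|)%N) (hA : (0 < #|A|)%N)
  (gamma : R) (hgamma : 0 <= gamma < 1)
  (M D : mdp R S A)
  (* optimal Q-functions of M and D *)
  (qM qD : S -> A -> R)
  (hqM : optimal_qfun gamma M qM) (hqD : optimal_qfun gamma D qD)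
  (* converged guided Q-functions on D *)
  (qhatD : S -> A -> R) (hqhatD : forall s a, qhatD s a = qD s a)
  (qhatDpi : policy R S A -> S -> A -> R)
  (hqhatDpi : forall pi s a, qhatDpi pi s a = qfun gamma D pi s a)
  (* fixed tie-breaking rule selecting the action of a policy *)
  (rule : (A -> R) -> A) (hrule : forall f, rule f \in argmax f)
  (* greedy action map on D *)
  (gD : S -> A) (hgD : forall s, gD s \in argmax (qD s))
  (s : S) (astar : A) (hastar : astar \in argmax (qM s)) :
  let piD := det_policy R gD in
  qM s astar - qfun gamma M piD s (gD s) <=
    inf (range (fun pi : policy R S A =>
      (qM s astar - qhatD s astar)
      + (qhatD s astar - qhatDpi pi s (rule (pi s)))))
    + sup (range (fun pi : policy R S A =>
      qhatDpi pi s (rule (pi s)) - qfun gamma M pi s (rule (pi s)))).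
Proof.
cbv zeta; set piD := det_policy R gD.
pose f pi := qfun gamma D pi s (rule (pi s)).
have ruleD : rule (piD s) = gD s by apply: argmax_dirac (hrule _).
have f_max pi : f pi <= f piD.
  (* The chain is [f pi <= qD s (rule (pi s)) <= qD s (gD s) <= f piD], built from its right end. *)
  rewrite {2}/f ruleD; apply: le_trans (optimal_le_qfun_greedy hgamma _ _ hqD hgD).
  apply: le_trans (qfun_le_optimal hgamma _ _ _ hqD) _.
  by have := hgD s; rewrite inE => /forallP.
apply: (@le_trans _ _ ((qM s astar - f piD) +
    (f piD - qfun gamma M piD s (gD s)))); first by rewrite addrA subrK.
apply: lerD.
  apply: lb_le_inf; first by exists ((qM s astar - qhatD s astar) +
    (qhatD s astar - qhatDpi piD s (rule (piD s)))); exists piD.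
  by move=> _ [pi _ <-]; rewrite addrA subrK lerD2l lerN2 hqhatDpi; exact: f_max.
apply: ub_le_sup; last by exists piD => //; rewrite hqhatDpi ruleD /f ruleD.
have [c cM] := qfun_lower_bound hgamma M.
exists (f piD - c) => _ [pi _ <-].
by rewrite hqhatDpi lerB //; exact: f_max.
Qed.
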